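(* Let $m>0$, let $V:\mathbb{R}\to\mathbb{R}$ be smooth, and let $H(x^1,x^2)=\frac{1}{2m}(x^2)^2+V(x^1)$, where in the term $(x^2)^2$ the coordinate $x^2$ (the momentum) is squared. The trajectories of the one-dimensional (one degree of freedom) Hamiltonian dynamical system $$\frac{dx^1}{dt}=\frac1m x^2,\qquad \frac{dx^2}{dt}=-V'(x^1)$$ are Jacobi stable if and only if $V''(x)>0$ for all $x$.
   Context: A prime denotes the derivative with respect to $x^1$. Repeated indices are summed. For a system of second order ODEs $\frac{d^2x^i}{dt^2}+2G^i(x,y,t)=0$, $i=1,\dots,n$, with $y^i=dx^i/dt$ and $G^i$ smooth, set $N^i_j=\partial G^i/\partial y^j$ and $G^i_{jl}=\partial N^i_j/\partial y^l$. The curvature deviation tensor is $$P^i_j=-2\frac{\partial G^i}{\partial x^j}-2G^lG^i_{jl}+y^l\frac{\partial N^i_j}{\partial x^l}+N^i_lN^l_j+\frac{\partial N^i_j}{\partial t},$$ with $x^i,y^i,t$ treated as independent variables. To the Hamiltonian system one associates the second order system obtained by differentiating in $t$: $\ddot x^1=\frac1m y^2$, $\ddot x^2=-V''(x^1)y^1$, i.e. $G^1=-\frac{1}{2m}y^2$, $G^2=\frac12V''(x^1)y^1$; its curvature deviation tensor is denoted $P_H$. Jacobi stability: considering nearby trajectories $x^i(t),\tilde x^i(t)$ with $\|x^i(t_0)-\tilde x^i(t_0)\|=0$ and $\|\dot x^i(t_0)-\dot{\tilde x}^i(t_0)\|\neq0$ (norm induced by a positive definite inner product), the trajectories of the Hamiltonian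 system are by definition Jacobi stable if and only if the real parts of the eigenvalues of the matrix $P_H$ are strictly negative everywhere (at all $(x^1,x^2,y^1,y^2)$); otherwise they are Jacobi unstable. *)

(* Defs.v *)
From HB Require Import structures.
From mathcomp Require Import all_boot all_order all_algebra.
From mathcomp Require Import all_classical all_reals all_analysis.
From mathcomp Require Import complex ring.

Set Implicit Arguments.
Unset Strict Implicit.
Unset Printing Implicit Defensive.

Import Order.TTheory GRing.Theory Num.Theory.
Import numFieldNormedType.Exports.

Local Open Scope classical_set_scope.
Local Open Scope ring_scope.

Definition partial (R : realType) (n : nat) (f : 'rV[R]_n -> R) (j : 'I_n)
    (x : 'rV[R]_n) : R :=
  'D_(delta_mx 0 j) f x.

(* [sode R n] is the type of the data (G^i) of a second order system
   d^2x^i/dt^2 + 2 G^i(x, y, t) = 0 with y^i = dx^i/dt. *)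
Definition sode (R : realType) (n : nat) : Type :=
  'rV[R]_n -> 'rV[R]_n -> R -> 'rV[R]_n.

Section Curvature.
Variables (R : realType) (n : nat) (G : sode R n).
Implicit Types (x y : 'rV[R]_n) (t : R) (i j l : 'I_n).

Definition nonlinear_connection x y t i j : R :=
  partial (fun y' => G x y' t 0 i) j y.

Definition berwald_connection x y t i j l : R :=
  partial (fun y' => nonlinear_connection x y' t i j) l y.

Definition curvature_deviation x y t : 'M[R]_n :=
  \matrix_(i, j)
    (- 2 * partial (fun x' => G x' y t 0 i) j x
     - 2 * (\sum_l G x y t 0 l * berwald_connection x y t i j l)
     + \sum_l y 0 l * partial (fun x' => nonlinear_connection x' y t i j) l x
     + \sum_l nonlinear_connection x y t i l * nonlinear_connection x y t l j
     + derive1 (fun t' => nonlinear_connection x y t' i j) t).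

(* The eigenvalues are the complex ones, hence the embedding of the real
   matrix in 'M[R[i]]_n. *)
Definition jacobi_stable_sode : Prop :=
  forall x y t (lambda : R[i]),
    eigenvalue (map_mx (real_complex R) (curvature_deviation x y t)) lambda ->
    complex.Re lambda < 0.

End Curvature.

(* Differentiating dx^i/dt = f^i(x) in t gives
   d^2x^i/dt^2 = sum_l (df^i/dx^l) y^l. *)
Definition sode_of_field (R : realType) (n : nat)
    (f : 'rV[R]_n -> 'rV[R]_n) : sode R n :=
  fun x y _ =>
    \row_i (- 2^-1 * \sum_l partial (fun x' => f x' 0 i) l x * y 0 l).

Definition jacobi_stable (R : realType) (n : nat)
    (f : 'rV[R]_n -> 'rV[R]_n) : Prop :=
  jacobi_stable_sode (sode_of_field f).

(* In dimension 2 the coordinates x^1 (position) and x^2 (momentum) are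
   [x 0 0] and [x 0 1]. *)
Definition hamiltonian (R : realType) (m : R) (V : R -> R) (x : 'rV[R]_2) : R :=
  (2 * m)^-1 * x 0 1 ^+ 2 + V (x 0 0).

Definition hamiltonian_field (R : realType) (H : 'rV[R]_2 -> R)
    (x : 'rV[R]_2) : 'rV[R]_2 :=
  \row_i (if i == 0 then partial H 1 x else - partial H 0 x).

Definition smooth (R : realType) (V : R -> R) : Prop :=
  forall (k : nat) (x : R), derivable V^`(k)%classic x 1.

Lemma partialE (R : realType) (n : nat) (f : 'rV[R]_n -> R) (j : 'I_n) x :
  partial f j x = derive1 (fun h => f (x + h *: delta_mx 0 j)) 0.
Proof.
rewrite /partial derive1E /derive; set F := (fun h => _); set F' := (fun h => _).
suff -> : F = F' by [].
apply/funext => h; rewrite /F /F' /= !addr0 scale0r addr0.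
by rewrite [_ + x]addrC -[h *: 1]/(h * 1) mulr1.
Qed.

(* The field of [hamiltonian m V] is (x^2 / m, - V'(x^1)). *)
Lemma hamiltonian_fieldE (R : realType) (m : R) (V : R -> R) (x : 'rV[R]_2) :
  0 < m -> smooth V ->
  hamiltonian_field (hamiltonian m V) x =
  \row_i (if i == 0 then m^-1 * x 0 1 else - derive1 V (x 0 0)).
Proof.
move=> m0 sV; apply/rowP => i; rewrite !mxE; case: ifP => _.
- rewrite partialE /hamiltonian.
  rewrite (_ : (fun h => _) = fun h : R => (2 * m)^-1 * (x 0 1 + h) ^+ 2 + V (x 0 0)); last first.
    by apply/funext => h; rewrite !mxE /= mulr0 mulr1 addr0.
  rewrite derive1E.
  have H : is_derive (0:R) (1:R) (fun h : R => (2 * m)^-1 * (x 0 1 + h) ^+ 2 + V (x 0 0)) (m^-1 * x 0 1).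
    apply: is_derive_eq.
    have mn0 : m != 0 by rewrite gt_eqF.
    by rewrite /GRing.scale /=; field.
  by rewrite derive_val.
- rewrite partialE /hamiltonian.
  rewrite (_ : (fun h => _) = fun h : R => (2 * m)^-1 * x 0 1 ^+ 2 + V (x 0 0 + h)); last first.
    by apply/funext => h; rewrite !mxE /= mulr0 mulr1 addr0.
  congr (- _).
  have dV : is_derive (x 0 0 + 0) (1 : R) V (derive1 V (x 0 0)).
    rewrite addr0; apply: DeriveDef; first exact: (sV 0%N).
    by rewrite derive1E.
  have dV2 : is_derive (0:R) (1:R) (V \o (fun h => x 0 0 + h)) (derive1 V (x 0 0) * 1).
    by apply: (is_derive1_comp dV); apply: is_derive_eq; rewrite add0r.
  rewrite derive1E.
  have H : is_derive (0:R) (1:R) (fun h : R => (2 * m)^-1 * x 0 1 ^+ 2 + (V \o (fun h => x 0 0 + h)) h) (derive1 V (x 0 0)).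
    by apply: is_derive_eq; rewrite /GRing.scale /=; ring.
  by rewrite derive_val.
Qed.

Lemma partial_lin (R : realType) (c : R) (k j : 'I_2) (x : 'rV[R]_2) :
  partial (fun x' => c * x' 0 k) j x = c * (j == k)%:R.
Proof.
rewrite partialE derive1E.
rewrite (_ : (fun h => _) = fun h : R => c * x 0 k + (c * (j == k)%:R) * h); last first.
  by apply/funext => h; rewrite !mxE eqxx /= eq_sym; ring.
have H : is_derive (0:R) (1:R) (fun h : R => c * x 0 k + (c * (j == k)%:R) * h) (c * (j == k)%:R).
  apply: is_derive_eq.
  by rewrite /GRing.scale /=; ring.
by rewrite derive_val.
Qed.

Lemma partial_fun (R : realType) (W : R -> R) (j : 'I_2) (x : 'rV[R]_2) :
  derivable W (x 0 0) 1 ->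
  partial (fun x' => W (x' 0 0)) j x = (j == 0)%:R * derive1 W (x 0 0).
Proof.
move=> dW; rewrite partialE derive1E.
rewrite (_ : (fun h => _) = W \o (fun h : R => x 0 0 + (j == 0)%:R * h)); last first.
  by apply/funext => h; rewrite !mxE eqxx /= eq_sym; congr W; ring.
have dV : is_derive (x 0 0 + (j == 0)%:R * 0) (1 : R) W (derive1 W (x 0 0)).
  by rewrite mulr0 addr0; apply: DeriveDef => //; rewrite derive1E.
have H : is_derive (0:R) (1:R) (W \o (fun h : R => x 0 0 + (j == 0)%:R * h)) (derive1 W (x 0 0) * (j == 0)%:R).
  have dg : is_derive (0:R) (1:R) (fun h : R => x 0 0 + (j == 0)%:R * h) (j == 0)%:R.
    by apply: is_derive_eq; rewrite /GRing.scale /=; ring.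
  exact: (@is_derive1_comp _ W _ 0 _ _ dV dg).
by rewrite derive_val mulrC.
Qed.

(* G^1 = - y^2 / (2 m) and G^2 = V''(x^1) y^1 / 2. *)
Lemma sode_of_hamiltonian_fieldE (R : realType) (m : R) (V : R -> R)
    (x y : 'rV[R]_2) (t : R) :
  0 < m -> smooth V ->
  sode_of_field (hamiltonian_field (hamiltonian m V)) x y t =
  \row_i (if i == 0 then - (2 * m)^-1 * y 0 1
          else 2^-1 * derive1n 2 V (x 0 0) * y 0 0).
Proof.
move=> m0 sV; apply/rowP => i; rewrite !mxE.
have mn0 : m != 0 by rewrite gt_eqF.
have -> : (fun x' => hamiltonian_field (hamiltonian m V) x' 0 i) =
    if i == 0 then (fun x' => m^-1 * x' 0 1) else (fun x' => - derive1 V (x' 0 0)).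
  by apply/funext => x'; rewrite hamiltonian_fieldE // mxE; case: ifP.
have e : lift ord0 ord0 = 1 :> 'I_2 by apply/val_inj.
rewrite big_ord_recl big_ord1 e; case: ifP => _.
- by rewrite !partial_lin /=; field.
- have dN : derivable (fun u => - derive1 V u) (x 0 0) 1.
    exact: (derivableN (sV 1%N (x 0 0))).
  rewrite !(@partial_fun _ (fun u => - derive1 V u)) //=.
  have -> : derive1 (fun u => - derive1 V u) (x 0 0) = - derive1n 2 V (x 0 0).
    by rewrite derive1E (@deriveN _ _ _ (derive1 V)) ?derive1nS ?derive1E//; exact: (sV 1%N).
  rewrite -[derive1 (derive1 V) (x 0 0)]/(derive1n 2 V (x 0 0)); move: (derive1n 2 V _) => d; by field.
Qed.

(* Main.v *)
Require Import Defs.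
From mathcomp Require Import all_boot all_order all_algebra.
From mathcomp Require Import all_classical all_reals all_analysis.
From mathcomp Require Import complex ring.
Import Order.TTheory GRing.Theory Num.Theory.
Import numFieldNormedType.Exports.
Local Open Scope ring_scope.

(** The deviation tensor can be computed in full. The semispray
    [G^1 = - y^2 / (2 m)], [G^2 = V''(x^1) y^1 / 2] is linear in [y], so its
    nonlinear connection [N] depends on [x^1] only and the Berwald connection
    vanishes. In
      [P = - 2 dG/dx + y^l dN/dx^l + N^2]
    the first two terms differentiate with respect to [x^1], and [x^1] enters
    only [G^2] and [N^2_1]: they contribute to the single entry [P^2_1]. Since
    [N] is antidiagonal with off-diagonal entries [- 1 / (2 m)] and [V'' / 2],
    its square is the scalar matrix [- V'' / (4 m)]. Hence [P] is lower
    triangular with both diagonal entries equal to [- V'' / (4 m)]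
    ([curvature_deviation_hamiltonianE]), so this number is its only complex
    eigenvalue ([eigenvalue_curvature_hamiltonian]); as [m > 0], it is negative
    everywhere exactly when [V''] is positive everywhere. *)

Lemma eigenvalue_trig_const (F : fieldType) (n : nat) (A : 'M[F]_n.+1) (p a : F) :
  is_trig_mx A -> (forall i, A i i = p) -> eigenvalue A a = (a == p).
Proof.
move=> trA diagA; rewrite eigenvalue_root_char char_poly_trig //.
under eq_bigr do rewrite diagA.
by rewrite prodr_const card_ord root_exp_XsubC.
Qed.

Lemma big_ord2 (R : pzSemiRingType) (F : 'I_2 -> R) : \sum_l F l = F 0 + F 1.
Proof.
by rewrite big_ord_recl big_ord1; congr (_ + F _); exact: val_inj.
Qed.

Lemma partial_cst (R : realType) (n : nat) (c : R) (j : 'I_n) (x : 'rV[R]_n) :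
  partial (fun=> c) j x = 0.
Proof. exact: derive_cst. Qed.

(** The entries of [G] and [N] that vary with [x] have this shape, with [W] the
    second derivative of [V] and the constants in [x] collected in [a] and [b]. *)
Lemma partial_scale_comp (R : realType) (W : R -> R) (w a b : R) (l : 'I_2)
    (x : 'rV[R]_2) :
  is_derive (x 0 0) 1 W w ->
  partial (fun x' : 'rV[R]_2 => a * W (x' 0 0) * b) l x = a * w * b * (l == 0)%:R.
Proof.
move=> dW.
have daWb : is_derive (x 0 0) (1 : R) (fun u => a * W u * b) (a * w * b).
  by apply: is_derive_eq; rewrite /GRing.scale /=; ring.
rewrite (partial_fun (W := fun u => a * W u * b)) //.
by rewrite derive1E derive_val mulrC.
Qed.

Variant ord2_spec : 'I_2 -> Prop := Ord2_0 : ord2_spec 0 | Ord2_1 : ord2_spec 1.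

Lemma ord2P (i : 'I_2) : ord2_spec i.
Proof.
by case: i => [[|[|//]] lt_i2]; [have -> : Ordinal lt_i2 = 0 by exact: val_inj
  | have -> : Ordinal lt_i2 = 1 by exact: val_inj]; constructor.
Qed.

Section HamiltonianCurvature.
Context (R : realType) (m : R) (V : R -> R).
Context (m_gt0 : 0 < m) (V_smooth : smooth V).

Local Notation G := (sode_of_field (hamiltonian_field (hamiltonian m V))).

Lemma nonlinear_connection_hamiltonianE (x y : 'rV[R]_2) (t : R) (i j : 'I_2) :
  nonlinear_connection G x y t i j =
  if i == 0 then - (2 * m)^-1 * (j == 1)%:R
  else 2^-1 * V^`(2)%classic (x 0 0) * (j == 0)%:R.
Proof.
rewrite /nonlinear_connection.
under eq_fun do rewrite sode_of_hamiltonian_fieldE // mxE.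
by case: eqP => _; rewrite partial_lin.
Qed.

Lemma berwald_connection_hamiltonian0 (x y : 'rV[R]_2) (t : R) (i j l : 'I_2) :
  berwald_connection G x y t i j l = 0.
Proof.
rewrite /berwald_connection.
under eq_fun do rewrite nonlinear_connection_hamiltonianE.
exact: partial_cst.
Qed.

(** The third derivative of [V] enters the entry (2,1) twice, as
    [- V''' y^1] from [- 2 dG^2/dx^1] and as [V''' y^1 / 2] from
    [y^l dN^2_1/dx^l]. *)
Lemma curvature_deviation_hamiltonianE (x y : 'rV[R]_2) (t : R) :
  curvature_deviation G x y t =
  \matrix_(i, j)
    (- (4 * m)^-1 * V^`(2)%classic (x 0 0) * (i == j)%:R
     - 2^-1 * V^`(3)%classic (x 0 0) * y 0 0 * ((i == 1) && (j == 0))%:R).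
Proof.
have m_neq0 : m != 0 by rewrite gt_eqF.
have dV2 : is_derive (x 0 0) (1 : R) V^`(2)%classic (V^`(3)%classic (x 0 0)).
  by apply: DeriveDef; [exact: V_smooth|rewrite [in RHS]derive1nS derive1E].
have dG i j : partial (fun x' => G x' y t 0 i) j x =
    2^-1 * V^`(3)%classic (x 0 0) * y 0 0 * ((i == 1) && (j == 0))%:R.
  under eq_fun do rewrite sode_of_hamiltonian_fieldE // mxE.
  case: (ord2P i) => /=; first by rewrite partial_cst mulr0.
  exact: partial_scale_comp.
have dN i j l : partial (fun x' => nonlinear_connection G x' y t i j) l x =
    2^-1 * V^`(3)%classic (x 0 0) * (j == 0)%:R * ((i == 1) && (l == 0))%:R.
  under eq_fun do rewrite nonlinear_connection_hamiltonianE.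
  case: (ord2P i) => /=; first by rewrite partial_cst mulr0.
  exact: partial_scale_comp.
have dNt i j : derive1 (fun t' => nonlinear_connection G x y t' i j) t = 0.
  under eq_fun do rewrite nonlinear_connection_hamiltonianE.
  by rewrite derive1_cst.
have NE := nonlinear_connection_hamiltonianE x y t.
have BE := berwald_connection_hamiltonian0 x y t.
(* Only the relations above matter from here on. The semispray and the
   derivatives of V are generalized, and each sum is expanded by position, so
   that matching cannot unfold them; the conversions involved are very slow. *)
move: (G) (V^`(2)%classic (x 0 0)) (V^`(3)%classic (x 0 0)) dG dN dNt NE BE {dV2}.
move=> S v2 v3 dG dN dNt NE BE.
apply/matrixP => i j; rewrite [LHS]mxE.
rewrite [X in _ - _ * X + _ + _ + _]big_ord2 [X in _ + X + _ + _]big_ord2.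
rewrite [X in _ + X + _]big_ord2.
rewrite mxE dG dNt !BE !dN !NE.
case: (ord2P i); case: (ord2P j); rewrite /= ?mulr0 ?mulr1.
all: by field.
Qed.

Lemma eigenvalue_curvature_hamiltonian (x y : 'rV[R]_2) (t : R) (a : R[i]%C) :
  eigenvalue (map_mx (real_complex R) (curvature_deviation G x y t)) a =
  (a == real_complex R (- (4 * m)^-1 * V^`(2)%classic (x 0 0))).
Proof.
rewrite curvature_deviation_hamiltonianE.
suff eigE (p q : R) : eigenvalue (map_mx (real_complex R) (\matrix_(i < 2, j < 2)
    (p * (i == j)%:R - q * ((i == 1) && (j == 0))%:R))) a = (a == real_complex R p).
  exact: eigE.
apply: eigenvalue_trig_const => [|i]; last first.
  by rewrite !mxE; case: (ord2P i); rewrite /= mulr0 subr0 mulr1.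
apply/is_trig_mxP => i j.
by case: (ord2P i); case: (ord2P j); rewrite //= !mxE !mulr0 subr0 rmorph0.
Qed.

End HamiltonianCurvature.

Theorem theorem5p1 (R : realType) (m : R) (V : R -> R)
    (m_gt0 : 0 < m) (V_smooth : smooth V) :
  jacobi_stable (hamiltonian_field (hamiltonian m V)) <->
  forall x : R, 0 < V^`(2)%classic x.
Proof.
have signE x : (- (4 * m)^-1 * V^`(2)%classic x < 0) = (0 < V^`(2)%classic x).
  by rewrite mulNr oppr_lt0 pmulr_rgt0 // invr_gt0 mulr_gt0.
split=> [stableV x|V2_gt0 x y t a].
  (* The eigenvalue depends on the position only, so any state over the
     position x will do. *)
  have -> : x = (const_mx x : 'rV[R]_2) 0 0 by rewrite mxE.
  rewrite -signE; set p := - _ * _.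
  apply: (stableV (const_mx x) 0 0 (real_complex R p)).
  by rewrite eigenvalue_curvature_hamiltonian.
by rewrite eigenvalue_curvature_hamiltonian // => /eqP -> /=; rewrite signE.
Qed.
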